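(* Let $c:=\ln(4/3)$ and $b:=(1-e^{-c})/c$. For every integer $n\ge1$ and every real $p$ with $c/n\ge p\ge 0$, if $X$ is a random variable having the binomial distribution with parameters $n$ and $p$, then $$\mathsf{P}(X>\mathsf{E}X)=1-(1-p)^n\ge \max(1,bn)\,p .$$
   Context: A random variable $X$ has the binomial distribution with parameters $n$ and $p$ if $\mathsf{P}(X=k)=\binom nk p^k(1-p)^{n-k}$ for $k=0,1,\dots,n$ (with $0^0=1$); its expectation is $\mathsf{E}X=np$. *)

(* Defs.v *)
From HB Require Import structures.
From mathcomp Require Import all_boot all_order all_algebra.
From mathcomp Require Import all_classical all_reals all_analysis.

Set Implicit Arguments.
Unset Strict Implicit.
Unset Printing Implicit Defensive.

Import Order.TTheory GRing.Theory Num.Theory.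
Import numFieldNormedType.Exports.

Local Open Scope classical_set_scope.
Local Open Scope ring_scope.

(* [X] is real-valued. No condition is put on its values outside {0, ..., n}:
   for 0 <= p <= 1 the masses below already sum to 1. *)
Definition has_binomial_distribution (d : measure_display)
    (T : measurableType d) (R : realType) (P : probability T R)
    (X : {RV P >-> R}) (n : nat) (p : R) : Prop :=
  forall k : nat, (k <= n)%N ->
    P [set w | X w = k%:R] = (binomial_pmf n p k)%:E.

Definition cst_c (R : realType) : R := ln (4%:R / 3%:R).

Definition cst_b (R : realType) : R := (1 - expR (- cst_c R)) / cst_c R.

(* Main.v *)
(* Almost surely [X] takes values in {0, ..., n}, so [E X = np].  As
   [np <= c < 1], the event [X > E X] is almost surely the event [X <> 0], of
   probability [1 - (1-p)^n].  The bound by [p] is [(1-p)^n <= 1-p].  The other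
   bound follows from [(1-p)^n <= exp (-np)] and, [x |-> exp (-x)] being convex,
   from the fact that on [0, c] its graph lies below the chord, which is the
   line [1 - b x]. *)
Require Import Defs.
From HB Require Import structures.
From mathcomp Require Import all_boot all_order all_algebra.
From mathcomp Require Import all_classical all_reals all_analysis.
From mathcomp Require Import unstable measurable_realfun ring lra.

Set Implicit Arguments.
Unset Strict Implicit.
Unset Printing Implicit Defensive.

Import Order.TTheory GRing.Theory Num.Theory.
Import numFieldNormedType.Exports.

Local Open Scope classical_set_scope.
Local Open Scope ring_scope.

Lemma sum_binomial_pmf (R : realType) (n : nat) (p : R) :
  \sum_(k < n.+1) binomial_pmf n p k = 1.
Proof.
rewrite -[RHS](expr1n _ n) -[in RHS](subrK p 1) exprDn.
by apply: eq_bigr => i _; rewrite /binomial_pmf /onem mulrC.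
Qed.

(** The absorption identity [k * 'C(n, k) = n * 'C(n.-1, k.-1)] pulls out the factor [n * p] and
    leaves the total mass for [n.-1] trials, which is 1. *)
Lemma mean_binomial_pmf (R : realType) (n : nat) (p : R) :
  \sum_(k < n.+1) k%:R * binomial_pmf n p k = n%:R * p.
Proof.
case: n => [|n]; first by rewrite big_ord1 !mul0r.
rewrite big_ord_recl mul0r add0r -[RHS]mulr1.
rewrite -[X in _ = _ * X](sum_binomial_pmf n p) mulr_sumr.
apply: eq_bigr => i _; rewrite /binomial_pmf lift0 subSS exprS.
rewrite -[_ *+ 'C(n.+1, _)]mulr_natr -[_ *+ 'C(n, _)]mulr_natr.
transitivity (p * p ^+ i * (onem p) ^+ (n - i)
  * (i.+1 * 'C(n.+1, i.+1))%:R); first by rewrite natrM; ring.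
by rewrite -mul_bin_diag natrM; ring.
Qed.

Lemma expRN_le_chord (R : realType) (c x : R) : 0 < c -> 0 <= x <= c ->
  expR (- x) <= 1 - (1 - expR (- c)) / c * x.
Proof.
move=> c0 /andP[x0 xc].
have t0 : 0 <= x / c by rewrite divr_ge0// ltW.
have t1 : x / c <= 1 by rewrite ler_pdivrMr// mul1r.
(* [- x] is the convex combination of [- c] and [0] with weight [x / c] on [- c]. *)
have := convex_expR (Itv01 t0 t1) (- c) 0.
rewrite !convRE /= expR0 /onem !mulr0 addr0 mulrN mulfVK ?gt_eqF//.
move=> /le_trans; apply; rewrite le_eqVlt; apply/orP; left; apply/eqP.
by ring.
Qed.

(** The [n]-th power of [1 - p <= expR (- p)]; [p <= 1] keeps the base nonnegative, so that taking
    powers is monotone. *)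
Lemma onem_exp_le_expR (R : realType) (n : nat) (p : R) : p <= 1 ->
  (1 - p) ^+ n <= expR (- (n%:R * p)).
Proof.
move=> p1; rewrite -mulrN expRM_natl.
by apply: lerXn2r; rewrite ?nnegrE ?subr_ge0 ?expR_ge0//; exact: expR_ge1Dx.
Qed.

Lemma cst_c_gt0 (R : realType) : 0 < cst_c R.
Proof. by rewrite ln_gt0//; lra. Qed.

(** Apply [ln (1 + x) <= x] at [x = 1/3]. This places the mean [n * p] below 1, the least positive
    value of [X]. *)
Lemma cst_c_lt1 (R : realType) : cst_c R < 1.
Proof.
rewrite /cst_c (_ : 4%:R / 3%:R = 1 + 3%:R^-1 :> R); last by lra.
by apply: le_lt_trans (le_ln1Dx _) _; lra.
Qed.

Section binomial_random_variable.
Context (d : measure_display) (T : measurableType d) (R : realType).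
Variables (P : probability T R) (X : {RV P >-> R}) (n : nat) (p : R).
Hypothesis hX : has_binomial_distribution X n p.

Let measurable_level k : measurable [set w | X w = k%:R].
Proof.
by rewrite (_ : [set _ | _] = X @^-1` [set k%:R]).
Qed.

(** The [n.+1] level sets are disjoint and their masses sum to 1, so the complement of their union
    [A] is null. *)
Lemma binomial_ae_nat :
  {ae P, forall w, exists k : 'I_n.+1, X w = k%:R}.
Proof.
pose A := \big[setU/set0]_(k < n.+1) [set w | X w = k%:R].
have mA : measurable A by exact: bigsetU_measurable.
exists (~` A); split; first exact: measurableC.
- rewrite probability_setC// /A.
  rewrite (@measure_bigsetU _ _ _ P (fun k => [set w | X w = k%:R]))//.
    rewrite (eq_bigr (fun k : 'I_n.+1 => (binomial_pmf n p k)%:E)) => [|k _].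
      by rewrite sumEFin sum_binomial_pmf subee.
    by rewrite /= hX// -ltnS.
  by apply/trivIsetP => i j _ _ ij; apply/seteqP; split => // w [/= -> /eqP];
    rewrite eqr_nat (negbTE ij).
- apply: subsetC => w.
  rewrite /A -(bigcup_mkord n.+1 (fun k => [set w | X w = k%:R])).
  by move=> -[k /= kn Xk]; exists (Ordinal kn).
Qed.

Lemma expectation_binomial : ('E_P[X] = (n%:R * p)%:E)%E.
Proof.
rewrite expectation_def.
pose F (k : 'I_n.+1) w : \bar R :=
  ((k%:R)%:E * (\1_[set w | X w = k%:R] w)%:E)%E.
have mF k : measurable_fun setT (F k).
  apply: measurable_funeM; apply/measurable_EFinP.
  exact: measurable_indic.
(* Off a null set [X] is the sum of the [F k], since only the term of the value taken survives;
   nonnegativity then allows termwise integration. *)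
rewrite (@ae_eq_integral _ _ _ _ _ (fun w => \sum_k F k w)%E)//; first last.
- apply: filterS binomial_ae_nat => w [k Xk] _ /=.
  rewrite (bigD1 k)//= /F indicE mem_set// mule1 big1 ?adde0 ?Xk// => j jk.
  rewrite indicE memNset ?mule0//= Xk.
  by move/eqP; rewrite eqr_nat eq_sym; exact/negP.
- exact: emeasurable_sum.
- exact/measurable_EFinP.
rewrite ge0_integral_sum//; last first.
  by move=> k w _; rewrite /F -EFinM lee_fin mulr_ge0.
rewrite -mean_binomial_pmf -sumEFin; apply: eq_bigr => k _.
rewrite /F ge0_integralZl//=; last first.
  by apply/measurable_EFinP; exact: measurable_indic.
by rewrite integral_indic// setIT EFinM; congr *%E; apply: hX; rewrite -ltnS.
Qed.

Lemma binomial_prob_gt (a : R) : 0 <= a < 1 ->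
  P [set w | a < X w] = (1 - (1 - p) ^+ n)%:E.
Proof.
move=> /andP[a0 a1].
have mB : measurable [set w | a < X w].
  rewrite (_ : [set _ | _] = X @^-1` `]a, +oo[)//; last first.
    by apply/seteqP; split => w /=; rewrite in_itv/= andbT.
  exact: measurable_funPTI.
(* The two events agree only almost everywhere, so their probabilities are compared as integrals of
   indicators. *)
have -> : P [set w | a < X w] = P (~` [set w | X w = 0%:R]).
  rewrite -[LHS]expectation_indic//.
  rewrite -[RHS]expectation_indic; last exact: measurableC.
  rewrite unlock; apply: ae_eq_integral => //.
  - by apply/measurable_EFinP; exact: measurable_indic.
  - by apply/measurable_EFinP; apply: measurable_indic; exact: measurableC.
  apply: filterS binomial_ae_nat => w [k Xk] _ /=; congr (_%:E).
  rewrite !indicE; congr (nat_of_bool _)%:R; apply/idP/idP; rewrite !inE/= Xk.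
    by move=> ak k0; move: ak; rewrite k0 ltNge a0.
  (* A nonzero value is at least 1, hence above [a]. *)
  case: k {Xk} => -[|k] kn//= _.
  by rewrite (lt_le_trans a1)// ler1n.
(* The mass at 0 is [(1 - p) ^+ n], also when [p = 0], because [p ^+ 0 = 1]. *)
rewrite probability_setC// hX// /binomial_pmf /onem expr0 mul1r subn0 bin0.
by rewrite -EFinB.
Qed.

End binomial_random_variable.

Theorem proposition2 (R : realType) (d : measure_display)
    (T : measurableType d) (P : probability T R) (X : {RV P >-> R})
    (n : nat) (p : R)
    (hn : (1 <= n)%N)
    (hp : 0 <= p <= cst_c R / n%:R)
    (hX : has_binomial_distribution X n p) :
  P [set w | ('E_P[X] < (X w)%:E)%E] = (1 - (1 - p) ^+ n)%:E /\
  Num.max 1 (cst_b R * n%:R) * p <= 1 - (1 - p) ^+ n.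
Proof.
have n0 : 0 < n%:R :> R by rewrite ltr0n.
have /andP[p0] := hp; rewrite ler_pdivlMr// mulrC => npc.
have np0 : 0 <= n%:R * p by rewrite mulr_ge0// ltW.
have np1 : n%:R * p < 1 := le_lt_trans npc (cst_c_lt1 R).
have p1 : p <= 1.
  by apply: le_trans (ltW np1); rewrite ler_peMl// ler1n.
split.
  rewrite (expectation_binomial hX).
  under eq_set do rewrite lte_fin.
  by apply: (binomial_prob_gt hX); rewrite np0.
(* As [p >= 0], the maximum splits into two bounds; the first holds because [1 - p] lies in [[0, 1]]
   and [n >= 1]. *)
rewrite maxr_pMl// mul1r ge_max; apply/andP; split.
  by rewrite lerBrDl -lerBrDr ler_iXnr// ?subr_ge0// gerBl.
rewrite lerBrDl -lerBrDr -mulrA (le_trans (onem_exp_le_expR n p1))//.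
(* By definition [- cst_b R] is the slope of the chord on [[0, c]], used here at [x = n * p]. *)
by apply: expRN_le_chord; rewrite ?cst_c_gt0 ?np0.
Qed.
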